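(* Let $\mathcal{H}$ be a right quaternionic Hilbert space, $I$ a countable set, $L\in\mathbb{B}(\mathcal{H})$, and let $\{u_i\}_{i\in I}$ be a frame for $\mathcal{H}$ with frame bounds $A\le B$. Then $\{Lu_i\}_{i\in I}$ is a frame for $\mathcal{H}$ if and only if $L$ is surjective.
   Context: $\mathbb{H}$ is the skew field of quaternions, with conjugation $q\mapsto\overline q$ and modulus $|q|$. A right quaternionic Hilbert space is a right $\mathbb{H}$-vector space $\mathcal{H}$ with a map $\langle\cdot\mid\cdot\rangle:\mathcal{H}\times\mathcal{H}\to\mathbb{H}$ (also written $\langle\cdot,\cdot\rangle$) satisfying $\langle u\mid v\rangle=\overline{\langle v\mid u\rangle}$, $\langle v\mid v\rangle>0$ for $v\neq0$, additivity in the second variable and $\langle v\mid uq\rangle=\langle v\mid u\rangle q$ for $q\in\mathbb{H}$, which is complete for the norm $\|u\|=\sqrt{\langle u\mid u\rangle}$. $\mathbb{B}(\mathcal{H})$ is the set of bounded right $\mathbb{H}$-linear operators $\mathcal{H}\to\mathcal{H}$. A family $\{u_i\}_{i\in I}$ in $\mathcal{H}$ is a frame for $\mathcal{H}$ with frame bounds $A\le B$ if $0<A\le B<\infty$ and $A\|u\|^2\le\sum_{i\in I}|\langle u_i,u\rangle|^2\le B\|u\|^2$ for all $u\in\mathcal{H}$; it is a frame if it is one for some such bounds. *)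

(* Defs.v *)
From HB Require Import structures.
From mathcomp Require Import all_boot all_order all_algebra.
From mathcomp Require Import ring lra.
From mathcomp Require Import all_classical all_reals all_analysis.

Set Implicit Arguments.
Unset Strict Implicit.
Unset Printing Implicit Defensive.

Import Order.TTheory GRing.Theory Num.Theory.
Import numFieldNormedType.Exports.

Local Open Scope classical_set_scope.
Local Open Scope ring_scope.

(* [Quaternion a b c d] is a + b i + c j + d k. *)
Record quaternion (R : Type) : Type :=
  Quaternion { qre : R; qi : R; qj : R; qk : R }.

Section QuaternionRing.
Variable R : realType.
Local Notation H := (quaternion R).
Implicit Types p q : H.

Definition tuple_of_quaternion q : R * R * R * R := (qre q, qi q, qj q, qk q).
Definition quaternion_of_tuple (t : R * R * R * R) : H :=
  let: (a, b, c, d) := t in Quaternion a b c d.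

Lemma tuple_of_quaternionK : cancel tuple_of_quaternion quaternion_of_tuple.
Proof. by case. Qed.

HB.instance Definition _ := Choice.copy H (can_type tuple_of_quaternionK).

Definition real_quaternion (a : R) : H := Quaternion a 0 0 0.
Definition addq p q : H :=
  Quaternion (qre p + qre q) (qi p + qi q) (qj p + qj q) (qk p + qk q).
Definition oppq p : H := Quaternion (- qre p) (- qi p) (- qj p) (- qk p).
(* i ^ 2 = j ^ 2 = k ^ 2 = i j k = -1 *)
Definition mulq p q : H :=
  Quaternion
    (qre p * qre q - qi p * qi q - qj p * qj q - qk p * qk q)
    (qre p * qi q + qi p * qre q + qj p * qk q - qk p * qj q)
    (qre p * qj q - qi p * qk q + qj p * qre q + qk p * qi q)
    (qre p * qk q + qi p * qj q - qj p * qi q + qk p * qre q).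

Definition conjq q : H := Quaternion (qre q) (- qi q) (- qj q) (- qk q).

Definition modq q : R :=
  Num.sqrt (qre q ^+ 2 + qi q ^+ 2 + qj q ^+ 2 + qk q ^+ 2).

Let quaternion_ext p q :
  qre p = qre q -> qi p = qi q -> qj p = qj q -> qk p = qk q -> p = q.
Proof. by case: p; case: q => /= ? ? ? ? ? ? ? ? -> -> -> ->. Qed.

Let addqA : associative addq.
Proof. by move=> p q r; apply: quaternion_ext => /=; ring. Qed.
Let addqC : commutative addq.
Proof. by move=> p q; apply: quaternion_ext => /=; ring. Qed.
Let add0q : left_id (real_quaternion 0) addq.
Proof. by move=> p; apply: quaternion_ext => /=; ring. Qed.
Let addNq : left_inverse (real_quaternion 0) oppq addq.
Proof. by move=> p; apply: quaternion_ext => /=; ring. Qed.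
Let mulqA : associative mulq.
Proof. by move=> p q r; apply: quaternion_ext => /=; ring. Qed.
Let mul1q : left_id (real_quaternion 1) mulq.
Proof. by move=> p; apply: quaternion_ext => /=; ring. Qed.
Let mulq1 : right_id (real_quaternion 1) mulq.
Proof. by move=> p; apply: quaternion_ext => /=; ring. Qed.
Let mulqDl : left_distributive mulq addq.
Proof. by move=> p q r; apply: quaternion_ext => /=; ring. Qed.
Let mulqDr : right_distributive mulq addq.
Proof. by move=> p q r; apply: quaternion_ext => /=; ring. Qed.
Let oneq_neq0 : real_quaternion 1 != real_quaternion 0.
Proof. by apply/eqP => -[] /eqP; rewrite oner_eq0. Qed.

HB.instance Definition _ := GRing.isNzRing.Build H
  addqA addqC add0q addNq mulqA mul1q mulq1 mulqDl mulqDr oneq_neq0.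

Let normsq q := qre q ^+ 2 + qi q ^+ 2 + qj q ^+ 2 + qk q ^+ 2.

Definition invq q : H :=
  Quaternion (qre q / normsq q) (- qi q / normsq q)
             (- qj q / normsq q) (- qk q / normsq q).

Let normsq_neq0 q : q != 0 -> normsq q != 0.
Proof.
apply: contraNN; rewrite /normsq => /eqP s0; apply/eqP.
have h (x : R) : x ^+ 2 <= 0 -> x = 0.
  by move=> x0; apply/eqP; rewrite -sqrf_eq0 eq_le x0 sqr_ge0.
move: (sqr_ge0 (qre q)) (sqr_ge0 (qi q)) (sqr_ge0 (qj q)) (sqr_ge0 (qk q)).
by move=> ? ? ? ?; apply: quaternion_ext => /=; apply: h; lra.
Qed.

Let mulVq : {in [pred q : H | q != 0], left_inverse 1 invq *%R}.
Proof.
move=> q /normsq_neq0; rewrite /normsq => s0.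
by apply: quaternion_ext => /=; rewrite /normsq; field.
Qed.

Let mulqV : {in [pred q : H | q != 0], right_inverse 1 invq *%R}.
Proof.
move=> q /normsq_neq0; rewrite /normsq => s0.
by apply: quaternion_ext => /=; rewrite /normsq; field.
Qed.

Let unitqP (p q : H) : q * p = 1 /\ p * q = 1 -> [pred q : H | q != 0] p.
Proof.
case=> + _; apply: contra_eqN => /eqP ->.
by rewrite mulr0 eq_sym oner_eq0.
Qed.

Let invq_out : {in [predC [pred q : H | q != 0]], invq =1 id}.
Proof.
move=> q; rewrite !inE negbK => /eqP ->.
by apply: quaternion_ext; rewrite /= ?oppr0 mul0r.
Qed.

HB.instance Definition _ :=
  GRing.NzRing_hasMulInverse.Build H mulVq mulqV unitqP invq_out.

Lemma unitqE q : (q \is a GRing.unit) = (q != 0).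
Proof. by []. Qed.

End QuaternionRing.

(* A right vector space over the quaternions is a left module over the converse
   ring: for q : (quaternion R)^c, [q *: u] is the right multiple u q. *)
HB.mixin Record isRightQuaternionicInner (R : realType) V
    of GRing.Lmodule (quaternion R)^c V := {
  qinner : V -> V -> quaternion R;
  qinner_conj : forall u v, qinner u v = conjq (qinner v u);
  qinner_pos : forall v, v != 0 ->
    exists2 r : R, 0 < r & qinner v v = real_quaternion r;
  qinnerDr : forall v u w, qinner v (u + w) = qinner v u + qinner v w;
  qinnerZr : forall v u (q : quaternion R),
    qinner v ((q : (quaternion R)^c) *: u) = qinner v u * q
}.

#[short(type="rightQPreHilbertType")]
HB.structure Definition RightQPreHilbert (R : realType) :=
  { V of isRightQuaternionicInner R V & GRing.Lmodule (quaternion R)^c V }.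

(* [qinner u u] is a real quaternion, identified here with its real part. *)
Definition qnorm (R : realType) (V : rightQPreHilbertType R) (u : V) : R :=
  Num.sqrt (qre (qinner u u)).

HB.mixin Record isQComplete (R : realType) V of RightQPreHilbert R V := {
  qcauchy_cvg : forall x : nat -> V,
    (forall e : R, 0 < e ->
       exists N, forall m n, (N <= m)%N -> (N <= n)%N -> qnorm (x m - x n) < e) ->
    exists l : V, qnorm (x n - l) @[n --> \oo] --> (0 : R)
}.

#[short(type="rightQHilbertType")]
HB.structure Definition RightQHilbert (R : realType) :=
  { V of isQComplete R V & RightQPreHilbert R V }.

Definition bounded_operator (R : realType) (V : rightQHilbertType R)
    (L : V -> V) : Prop :=
  exists M : R, forall u : V, qnorm (L u) <= M * qnorm u.

Definition frame_with_bounds (R : realType) (V : rightQHilbertType R)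
    (I : choiceType) (u : I -> V) (A B : R) : Prop :=
  [/\ 0 < A, A <= B & forall v : V,
    ((A * qnorm v ^+ 2)%:E <=
       \esum_(i in [set: I]) (modq (qinner (u i) v) ^+ 2)%:E)%E /\
    (\esum_(i in [set: I]) (modq (qinner (u i) v) ^+ 2)%:E <=
       (B * qnorm v ^+ 2)%:E)%E].

Definition is_frame (R : realType) (V : rightQHilbertType R)
    (I : choiceType) (u : I -> V) : Prop :=
  exists A B : R, frame_with_bounds u A B.

(* Main.v *)
(* Let [S] be the adjoint of [L]. As [<L u_i, v> = <u_i, S v>], the frame sum of
   [L u_i] at [v] lies between [A |S v|^2] and [B |S v|^2], so [L u_i] is a frame
   iff [S] is bounded below, which is equivalent to surjectivity of [L]: if [S] is
   bounded below, [L S] is coercive, hence onto; the converse is an instance of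
   the uniform boundedness principle. Only the real inner product [Re <u, v>] is
   needed for the Hilbert space arguments. *)
Require Import Defs.
From HB Require Import structures.
From mathcomp Require Import all_boot all_order all_algebra.
From mathcomp Require Import ring lra.
From mathcomp Require Import all_classical all_reals all_analysis.

Set Implicit Arguments.
Unset Strict Implicit.
Unset Printing Implicit Defensive.

Import Order.TTheory GRing.Theory Num.Theory.
Import numFieldNormedType.Exports.

Local Open Scope classical_set_scope.
Local Open Scope ring_scope.

(** Evaluate at the minimiser s = -g / z. For z = 0 the quadratic is affine in s and would take the
    value -1 if g were nonzero. *)
Lemma discriminant_le (R : realFieldType) (e g z : R) : 0 <= z ->
  (forall s, 0 <= e + 2 * s * g + s ^+ 2 * z) -> g ^+ 2 <= z * e.
Proof.
rewrite le_eqVlt => /orP[/eqP <-|z0] quad.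
  have [->|g0] := eqVneq g 0; first by rewrite expr0n mul0r.
  have := quad (- (e + 1) / (2 * g)).
  rewrite mulr0 addr0 (_ : _ + _ = -1); last by field.
  by rewrite ler0N1.
have := quad (- g / z).
have -> : e + 2 * (- g / z) * g + (- g / z) ^+ 2 * z = (z * e - g ^+ 2) / z.
  by field; rewrite gt_eqF.
by rewrite pmulr_lge0 ?invr_gt0// subr_ge0.
Qed.

(** * The real inner product underlying the quaternionic one *)

Section RealInner.
Variables (R : realType) (H : rightQPreHilbertType R).
Implicit Types (u v w : H) (a : H -> H -> R) (s t : R).

Definition rscale (t : R) (u : H) : H := (real_quaternion t : (quaternion R)^c) *: u.

Definition rinner (u v : H) : R := qre (qinner u v).

(** Isolated from [rinner] because the representation lemma is applied to two forms: [rinner]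
    itself, to build the adjoint, and Re <S v, S w>, to solve L x = y. *)
Definition sym_form (a : H -> H -> R) : Prop :=
  [/\ forall u v, a u v = a v u,
      forall u v w, a u (v + w) = a u v + a u w,
      forall u v t, a u (rscale t v) = t * a u v
    & forall u, 0 <= a u u].

Lemma rscaleN1 u : rscale (-1) u = - u.
Proof.
rewrite /rscale (_ : real_quaternion (-1) = (-1 : (quaternion R)^c)) ?scaleN1r//.
(* In the ring, the imaginary parts of -1 are [- 0]. *)
exact: (congr1 (fun t => Quaternion (-1) t t t) (esym (@oppr0 R))).
Qed.

Lemma rinner_sym_form : sym_form rinner.
Proof.
split=> [u v|u v w|u v t|u]; rewrite /rinner.
- by rewrite qinner_conj.
- by rewrite qinnerDr.
- by rewrite qinnerZr /= !mulr0 !subr0 mulrC.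
- have [->|/qinner_pos[r r0 ->]] := eqVneq u 0; last exact: ltW.
  suff -> : qinner (0 : H) 0 = 0 by [].
  by apply: (@addrI _ (qinner (0 : H) 0)); rewrite -qinnerDr !addr0.
Qed.

Section SymForm.
Variables (a : H -> H -> R) (a_form : sym_form a).

Lemma sym_formC u v : a u v = a v u. Proof. by case: a_form. Qed.
Lemma sym_formDr u v w : a u (v + w) = a u v + a u w.
Proof. by case: a_form. Qed.
Lemma sym_formZr u v t : a u (rscale t v) = t * a u v.
Proof. by case: a_form. Qed.
Lemma sym_form_ge0 u : 0 <= a u u. Proof. by case: a_form. Qed.
Lemma sym_formBr u v w : a u (v - w) = a u v - a u w.
Proof. by rewrite -rscaleN1 sym_formDr sym_formZr mulN1r. Qed.
Lemma sym_formDl u v w : a (v + w) u = a v u + a w u.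
Proof. by rewrite sym_formC sym_formDr !(sym_formC u). Qed.
Lemma sym_formZl u v t : a (rscale t v) u = t * a v u.
Proof. by rewrite sym_formC sym_formZr (sym_formC u). Qed.
Lemma sym_formBl u v w : a (v - w) u = a v u - a w u.
Proof. by rewrite sym_formC sym_formBr !(sym_formC u). Qed.

Lemma sym_form_CauchySchwarz u v : a u v ^+ 2 <= a u u * a v v.
Proof.
rewrite mulrC; apply: discriminant_le => [|s]; first exact: sym_form_ge0.
have := sym_form_ge0 (u + rscale s v).
rewrite !(sym_formDl, sym_formDr, sym_formZl, sym_formZr) (sym_formC v u).
by congr (_ <= _); ring.
Qed.

End SymForm.

Local Notation inner_form := rinner_sym_form.

Lemma sqr_qnorm u : qnorm u ^+ 2 = rinner u u.
Proof. by rewrite sqr_sqrtr // (sym_form_ge0 inner_form). Qed.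

Lemma qnorm_ge0 u : 0 <= qnorm u. Proof. exact: sqrtr_ge0. Qed.

Lemma qnorm0 : qnorm (0 : H) = 0.
Proof.
apply/eqP; rewrite -sqrf_eq0 sqr_qnorm -{2}(subrr 0).
by rewrite (sym_formBr inner_form) subrr.
Qed.

Lemma rinner_eq0 u : rinner u u = 0 -> u = 0.
Proof.
move=> u0; apply/eqP/negPn/negP => /qinner_pos[r r0 e].
by move: u0 r0; rewrite /rinner e /= => ->; rewrite ltxx.
Qed.

Lemma rinner_ext u v : (forall w, rinner w u = rinner w v) -> u = v.
Proof.
move=> e; apply/eqP; rewrite -subr_eq0; apply/eqP/rinner_eq0.
by rewrite (sym_formBr inner_form) e subrr.
Qed.

Lemma rinner_le_qnorm u v : `|rinner u v| <= qnorm u * qnorm v.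
Proof.
rewrite -ler_sqr ?nnegrE ?mulr_ge0 ?qnorm_ge0 ?normr_ge0//.
by rewrite real_normK ?num_real// exprMn !sqr_qnorm (sym_form_CauchySchwarz inner_form).
Qed.

Lemma qnormD u v : qnorm (u + v) <= qnorm u + qnorm v.
Proof.
rewrite -ler_sqr ?nnegrE ?addr_ge0 ?qnorm_ge0// sqr_qnorm.
rewrite !(sym_formDl inner_form, sym_formDr inner_form) (sym_formC inner_form v u).
rewrite sqrrD !sqr_qnorm.
have := le_trans (ler_norm _) (rinner_le_qnorm u v); lra.
Qed.

Lemma qnorm_rscale t u : qnorm (rscale t u) = `|t| * qnorm u.
Proof.
apply/eqP; rewrite -(@eqrXn2 _ 2) ?mulr_ge0 ?qnorm_ge0 ?normr_ge0//.
rewrite exprMn !sqr_qnorm real_normK ?num_real//.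
by rewrite (sym_formZl inner_form) (sym_formZr inner_form) mulrA.
Qed.

Lemma qnormN u : qnorm (- u) = qnorm u.
Proof. by rewrite -rscaleN1 qnorm_rscale normrN1 mul1r. Qed.

Lemma qnormB u v : qnorm (u - v) = qnorm (v - u).
Proof. by rewrite -qnormN opprB. Qed.

End RealInner.

(** * Riesz and Lax-Milgram representation *)

Section Complete.
Variables (R : realType) (H : rightQHilbertType R).
Implicit Types (u v w : H).

Lemma qcauchy_limit (x : nat -> H) :
  (forall e : R, 0 < e ->
     exists N, forall m n, (N <= m)%N -> (N <= n)%N -> qnorm (x m - x n) < e) ->
  exists l : H, forall e : R, 0 < e -> exists N, forall n, (N <= n)%N ->
    qnorm (x n - l) < e.
Proof.
move=> /qcauchy_cvg[l xl]; exists l => e e0.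
move/cvgrPdist_lt: xl => /(_ e e0)[N _ NP].
exists N => n /NP /=; rewrite sub0r normrN.
by rewrite ger0_norm ?qnorm_ge0.
Qed.

(* The solution minimises [a x x - 2 f x]; the parallelogram law makes every
   minimising sequence Cauchy. *)
Lemma sym_form_represent (a : H -> H -> R) (f : H -> R) (c C K : R) :
  sym_form a -> 0 < c -> 0 <= K ->
  (forall x, c * rinner x x <= a x x) -> (forall x, a x x <= C * rinner x x) ->
  (forall x y, f (x + y) = f x + f y) -> (forall x t, f (rscale t x) = t * f x) ->
  (forall x, f x ^+ 2 <= K * rinner x x) ->
  exists l, forall z, a l z = f z.
Proof.
move=> af c0 K0 ac aC fD fZ fK.
pose F x := a x x - 2 * f x.
have ii := sym_form_ge0 (rinner_sym_form H).
have F_lb x : - (K / c) <= F x.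
  have r0 := ii x; have := fK x; have := ac x; rewrite /F.
  move: r0; set r := rinner x x; rewrite le_eqVlt => /orP[/eqP <-|r0] h1 h2.
    have f0 : f x = 0 by apply/eqP; rewrite -sqrf_eq0 eq_le sqr_ge0 -(mulr0 K) h2.
    rewrite f0 mulr0 subr0; apply: le_trans (sym_form_ge0 af x).
    by rewrite oppr_le0 divr_ge0// ltW.
  suff : - (K / c) <= c * r - 2 * f x by lra.
  (* Multiplied by r c > 0, the bound becomes a square plus K r - f(x)^2. *)
  suff : 0 <= r * (c * (c * r - 2 * f x + K / c)).
    by rewrite pmulr_rge0// pmulr_rge0//; lra.
  have -> : r * (c * (c * r - 2 * f x + K / c)) = (c * r - f x) ^+ 2 + (K * r - f x ^+ 2).
    by field; rewrite gt_eqF.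
  by rewrite addr_ge0 ?sqr_ge0// subr_ge0.
have Finf : has_inf (range F).
  by split; [exists (F 0); exists 0 | exists (- (K / c)) => _ [x _ <-]].
pose d := inf (range F).
have dF x : d <= F x by apply: ge_inf; [case: Finf | exists x].
have /choice[x xP] n : exists x, F x < d + n.+1%:R^-1.
  have n0 : 0 < n.+1%:R^-1 :> R by rewrite invr_gt0.
  by have [_ [x _ <-] h] := inf_adherent n0 Finf; exists x; exact: h.
(* The derivative of F at x n in direction z is 2 g. Since F (x n + s z) >= d > F (x n) - 1/(n+1)
   for every s, the discriminant bounds g. *)
have near_min n z : (a (x n) z - f z) ^+ 2 <= a z z * n.+1%:R^-1.
  set g := a (x n) z - f z.
  have quad s : 0 <= n.+1%:R^-1 + 2 * s * g + s ^+ 2 * a z z.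
    have := dF (x n + rscale s z); have := xP n; rewrite /F fD fZ /g.
    rewrite !(sym_formDl af, sym_formDr af, sym_formZl af, sym_formZr af).
    rewrite (sym_formC af z (x n)); clear.
    move: (n.+1%:R^-1) (a (x n) (x n)) (a (x n) z) (a z z) (f _) (f z) d.
    move=> *; lra.
  apply: discriminant_le quad; exact: (sym_form_ge0 af).
(* Evaluate F at the midpoint of u and v, where it is at least d. *)
have parallelogram u v : a (u - v) (u - v) <= 2 * (F u + F v - 2 * d).
  have := dF (rscale (2^-1) (u + v)); rewrite /F fZ fD.
  rewrite !(sym_formZl af, sym_formZr af, sym_formBl af, sym_formBr af).
  rewrite !(sym_formDl af, sym_formDr af) (sym_formC af v u); lra.
have C1 : 0 <= `|C| + 1 by rewrite addr_ge0.
have [] := @qcauchy_limit x.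
  move=> e e0.
  (* With 1/(m+1) and 1/(n+1) below c e^2 / 4, the parallelogram bound is below c e^2. *)
  have ce0 : 0 < c * e ^+ 2 / 4 by rewrite divr_gt0// mulr_gt0// exprn_gt0.
  have [N _ NP] := near_infty_natSinv_lt (PosNum ce0).
  exists N => m n /NP /= mN /NP /= nN.
  rewrite -ltr_sqr ?nnegrE ?qnorm_ge0 ?ltW// sqr_qnorm -(ltr_pM2l c0).
  apply: le_lt_trans (ac _) _; apply: le_lt_trans (parallelogram _ _) _.
  have := xP m; have := xP n; move: mN nN.
  move: (m.+1%:R^-1) (n.+1%:R^-1) => k k'; lra.
move=> l xl; exists l => z.
suff small e : 0 < e -> `|a l z - f z| <= e.
  apply/eqP; rewrite -subr_eq0 -normr_le0.
  by apply/ler_addgt0Pr => e /small; rewrite add0r.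
move=> e0.
pose Z := a z z; have Z0 : 0 <= Z := sym_form_ge0 af z.
(* D dominates both |C| Z and Z and stays positive when Z = 0. Then q = e^2 / (4 D) makes the
   squares of a(x n - l, z) and a(x n, z) - f z at most e^2 / 4. *)
pose D := (`|C| + 1) * (Z + 1).
have [CZD ZD] : `|C| * Z <= D /\ Z <= D.
  by rewrite /D; have := normr_ge0 C; split; nra.
have D0 : 0 < D by rewrite mulr_gt0 ?ltr_wpDl.
pose q := e ^+ 2 / (4 * D); have q0 : 0 < q by rewrite divr_gt0 ?exprn_gt0// mulr_gt0.
have [N _ NP] := near_infty_natSinv_lt (PosNum q0).
have [|M MP] := xl (Num.sqrt q); first by rewrite sqrtr_gt0.
pose n := maxn N M.
have kq : n.+1%:R^-1 < q by apply: NP; exact: leq_maxl.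
have rq : rinner (x n - l) (x n - l) < q.
  rewrite -sqr_qnorm -[q]sqr_sqrtr ?ltW// ltr_sqr ?nnegrE ?qnorm_ge0 ?sqrtr_ge0//.
  by apply: MP; exact: leq_maxr.
move: rq kq; have := near_min n z; have := sym_form_CauchySchwarz af (x n - l) z.
have := aC (x n - l); have := ii (x n - l); rewrite (sym_formBl af z) -/Z.
set r := rinner _ _; set s := a (x n - l) _; set k := _^-1 => r0 sC sZ kZ rq kq.
have k0 : 0 <= k by rewrite invr_ge0.
have qD : D * q = e ^+ 2 / 4 by rewrite /q; field; rewrite gt_eqF.
have sr : s * Z <= D * q.
  apply: (@le_trans _ _ (`|C| * r * Z)).
    by rewrite ler_wpM2r// (le_trans sC)// ler_wpM2r// ler_norm.
  by rewrite mulrAC; apply: ler_pM; [exact: mulr_ge0|by []| |exact: ltW].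
have kD : Z * k <= D * q.
  by apply: ler_pM => //; exact: ltW.
rewrite -ler_sqr ?nnegrE ?normr_ge0 ?ltW// real_normK ?num_real//.
set p := a (x n) z in sZ kZ; set p' := a l z in sZ *.
(* The two errors combine by (s - t)^2 <= 2 s^2 + 2 t^2, whose defect is (s + t)^2. *)
have := sqr_ge0 ((p - p') + (p - f z)); nra.
Qed.

(** * The adjoint of a bounded operator *)

Section Adjoint.
Variables (L : {linear H -> H}).
Hypothesis L_bounded : bounded_operator L.
Local Notation inner_form := (rinner_sym_form H).

Lemma bounded_operator_sqr :
  exists2 M : R, 0 <= M & forall u, rinner (L u) (L u) <= M * rinner u u.
Proof.
have [M MP] := L_bounded; exists (M ^+ 2) => [|u]; first exact: sqr_ge0.
rewrite -!sqr_qnorm -exprMn ler_sqr ?nnegrE ?qnorm_ge0//.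
exact: le_trans (qnorm_ge0 _) (MP u).
Qed.

(** Testing against r = 1, i, j, k reads off the four coordinates up to sign. This lifts identities
    of real parts to quaternionic ones. *)
Lemma qre_mul_inj (p q : quaternion R) :
  (forall r, qre (p * r) = qre (q * r)) -> p = q.
Proof.
move=> e; move: (e (Quaternion 1 0 0 0)) (e (Quaternion 0 1 0 0))
  (e (Quaternion 0 0 1 0)) (e (Quaternion 0 0 0 1)).
case: p q {e} => [a b c d] [a' b' c' d'] /= e1 e2 e3 e4.
by congr Quaternion; lra.
Qed.

(** Riesz representation of x -> Re <v, L x> gives the real part of the identity; replacing x by x q
    and using right linearity of L gives the rest. *)
Lemma adjoint_exists :
  exists S : H -> H, forall v x, qinner (S v) x = qinner v (L x).
Proof.
have [M M0 LM] := bounded_operator_sqr.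
suff /choice[S SP] : forall v, exists w, forall x, rinner w x = rinner v (L x).
  exists S => v x; apply: qre_mul_inj => q.
  by rewrite -!qinnerZr -linearZ; exact: SP.
move=> v; apply: (@sym_form_represent (@rinner R H) _ 1 1 (rinner v v * M)) => //.
- exact: rinner_sym_form.
- by rewrite mulr_ge0// (sym_form_ge0 inner_form).
- by move=> x; rewrite mul1r.
- by move=> x; rewrite mul1r.
- by move=> x y; rewrite linearD (sym_formDr inner_form).
- by move=> x t; rewrite linearZ (sym_formZr inner_form).
- move=> x; apply: le_trans (sym_form_CauchySchwarz inner_form _ _) _.
  by rewrite -mulrA ler_wpM2l// (sym_form_ge0 inner_form).
Qed.

Section AdjointBounds.
Variable S : H -> H.
Hypothesis S_adj : forall v x, qinner (S v) x = qinner v (L x).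

Lemma rinner_adjoint v x : rinner (S v) x = rinner v (L x).
Proof. by rewrite /rinner S_adj. Qed.

(** |S v|^4 = (Re <v, L S v>)^2 <= |v|^2 M |S v|^2; divide by |S v|^2. *)
Lemma adjoint_bounded :
  exists2 M : R, 0 <= M & forall v, rinner (S v) (S v) <= M * rinner v v.
Proof.
have [M M0 LM] := bounded_operator_sqr; exists M => // v.
have := sym_form_ge0 inner_form (S v); rewrite le_eqVlt => /orP[/eqP <-|s0].
  by rewrite mulr_ge0// (sym_form_ge0 inner_form).
rewrite -(ler_pM2l s0) -expr2 {1}rinner_adjoint.
apply: le_trans (sym_form_CauchySchwarz inner_form _ _) _.
have := LM (S v); have := sym_form_ge0 inner_form v; nra.
Qed.

(** The lower bound makes Re <S v, S w> coercive, so some l satisfies Re <S l, S w> = Re <y, w> for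
    all w; moving S across, L (S l) = y. *)
Lemma surjective_of_adjoint_bounded_below (c : R) : 0 < c ->
  (forall v, c * rinner v v <= rinner (S v) (S v)) -> forall y, exists x, L x = y.
Proof.
move=> c0 cS y; have [M _ SM] := adjoint_bounded.
pose a v w := rinner (S v) (S w).
(* [S] is given only as a function, so linearity of [a v] is read off the right-hand side. *)
have aE v w : a v w = rinner w (L (S v)).
  by rewrite /a (sym_formC inner_form) rinner_adjoint.
have af : sym_form a.
  split=> [v w|v w w'|v w t|v]; last exact: sym_form_ge0 inner_form _.
  - exact: (sym_formC inner_form).
  - by rewrite !aE (sym_formDl inner_form).
  - by rewrite !aE (sym_formZl inner_form).
have [||||l lP] := @sym_form_represent a (rinner y) c M (rinner y y) af c0 _ cS SM.
- exact: sym_form_ge0 inner_form _.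
- by move=> u v; exact: (sym_formDr inner_form).
- by move=> u t; exact: (sym_formZr inner_form).
- by move=> u; exact: (sym_form_CauchySchwarz inner_form).
exists (S l); apply: rinner_ext => w.
by rewrite -aE lP (sym_formC inner_form).
Qed.

(* Gliding hump: if unit vectors [e n] satisfy [|S (e n)| <= 3 ^- n / n.+1], then
   for suitable signs the series of [+- 3 ^- n.+1 e n] has a sum [z = L x] with
   [|<e n, z>| >= 3 ^- n.+1 / 2], whereas [|<e n, L x>| <= 3 ^- n / n.+1 |x|]. *)
Lemma adjoint_bounded_below_of_surjective : (forall y, exists x, L x = y) ->
  exists2 c : R, 0 < c & forall v, c * rinner v v <= rinner (S v) (S v).
Proof.
move=> L_surj; apply: contrapT => noc.
pose b (n : nat) : R := 3^-1 ^+ n / n.+1%:R.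
have b0 n : 0 < b n by rewrite divr_gt0 ?exprn_gt0 ?invr_gt0.
have /choice[e eP] (n : nat) : exists e : H, qnorm e = 1 /\
    forall x, `|rinner e (L x)| <= b n * qnorm x.
  (* Otherwise c = (b n)^2 would be a lower bound. Normalising such a v gives e n. *)
  have : exists v, rinner (S v) (S v) < b n ^+ 2 * rinner v v.
    apply: contrapT => h; apply: noc; exists (b n ^+ 2).
      by rewrite exprn_gt0.
    by move=> v; rewrite leNgt; apply/negP => ?; apply: h; exists v.
  move=> [v]; rewrite -!sqr_qnorm -exprMn.
  rewrite ltr_sqr ?nnegrE ?qnorm_ge0 ?mulr_ge0 ?qnorm_ge0 ?(ltW (b0 n))//.
  move=> vP; have v0 : 0 < qnorm v.
    rewrite lt_neqAle qnorm_ge0 andbT; apply/eqP => v0.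
    by move: vP; rewrite -v0 mulr0 ltNge qnorm_ge0.
  exists (rscale (qnorm v)^-1 v); split.
    by rewrite qnorm_rscale ger0_norm ?invr_ge0 ?qnorm_ge0// mulVf// gt_eqF.
  move=> x; rewrite (sym_formZl inner_form) -rinner_adjoint normrM.
  rewrite ger0_norm ?invr_ge0 ?qnorm_ge0// ler_pdivrMl//.
  apply: le_trans (rinner_le_qnorm _ _) _.
  by rewrite mulrCA mulrA ler_wpM2r ?qnorm_ge0// ltW.
(* The sign prevents cancellation: the new term adds its full length 3^-(n+1) to |Re <e n, y n>|. *)
pose sg (n : nat) (y : H) : R := (-1) ^+ (rinner (e n) y < 0)%R.
pose fix y (n : nat) : H :=
  if n is k.+1 then y k + rscale (sg k (y k) * 3^-1 ^+ k.+1) (e k) else 0.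
have norm_sg n z : `|sg n z| = 1 by rewrite normrX normrN1 expr1n.
have hump n : 3^-1 ^+ n.+1 <= `|rinner (e n) (y n.+1)|.
  rewrite /= (sym_formDr inner_form) (sym_formZr inner_form) -sqr_qnorm.
  rewrite (eP n).1 expr1n mulr1.
  have t0 : 0 < 3^-1 ^+ n.+1 :> R by rewrite exprn_gt0// invr_gt0.
  rewrite /sg; case: ltP => h; rewrite ?expr1 ?expr0 ?mulN1r ?mul1r.
    by rewrite ltr0_norm; lra.
  by rewrite ger0_norm; lra.
(* The increments are geometric of ratio 1/3, so what follows y (n+1) has norm at most half of the
   hump 3^-(n+1) and cannot erase it. *)
have tail n k : qnorm (y (n + k)%N - y n) <= (3^-1 ^+ n - 3^-1 ^+ (n + k)) / 2.
  elim: k => [|k IH].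
    by rewrite addn0 !subrr mul0r qnorm0.
  rewrite addnS /= addrAC; apply: le_trans (qnormD _ _) _.
  rewrite qnorm_rscale normrM norm_sg mul1r (eP _).1 mulr1.
  rewrite ger0_norm ?exprn_ge0 ?invr_ge0// exprS; lra.
have tail' n m : (n <= m)%N -> qnorm (y m - y n) <= 3^-1 ^+ n / 2.
  move=> nm; have := tail n (m - n)%N; rewrite subnKC// => /le_trans; apply.
  have : 0 <= 3^-1 ^+ m :> R by rewrite exprn_ge0// invr_ge0.
  lra.
have [z zP] : exists l : H, forall e : R, 0 < e -> exists N, forall n, (N <= n)%N ->
    qnorm (y n - l) < e.
  apply: qcauchy_limit => d d0.
  have [N NP] : exists N, 3^-1 ^+ N < d :> R.
    have [N _ /(_ N (leqnn _)) /= NP] := near_infty_natSinv_lt (PosNum d0).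
    exists N; apply: le_lt_trans NP.
    by rewrite exprVn lef_pV2 ?posrE ?exprn_gt0// -natrX ler_nat ltn_expl.
  exists N => m n mN nN.
  rewrite -(subrKA (y N)); apply: le_lt_trans (qnormD _ _) _.
  rewrite [X in _ + X]qnormB; have := tail' _ _ mN; have := tail' _ _ nN; lra.
have zlim n : qnorm (y n - z) <= 3^-1 ^+ n / 2.
  apply/ler_addgt0Pr => d /zP[N NP].
  have /NP h := leq_maxr n N; rewrite -(subrKA (y (maxn n N))).
  apply: le_trans (qnormD _ _) _; apply: lerD; last exact: ltW.
  by rewrite qnormB tail'// leq_maxl.
have [x xz] := L_surj z.
(* Hump minus tail leaves 3^-(n+1) / 2 = 3^-n / 6 <= b n |x|. Cancelling 3^-n bounds every n + 1 by
   6 |x|, against the Archimedean property. *)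
have bound n : n.+1%:R <= 6 * qnorm x.
  have := (eP n).2 x; rewrite xz.
  have := rinner_le_qnorm (e n) (y n.+1 - z).
  rewrite (sym_formBr inner_form) (eP n).1 mul1r.
  have := ler_normB (rinner (e n) (y n.+1) - rinner (e n) z) (- rinner (e n) z).
  rewrite opprK subrK normrN.
  have := hump n; have := zlim n.+1; rewrite exprS => h1 h2 h3 h4 h5.
  have t0 : 0 < 3^-1 ^+ n :> R by rewrite exprn_gt0// invr_gt0.
  have : 3^-1 ^+ n / 6 <= b n * qnorm x by lra.
  rewrite /b -mulrA ler_pM2l// mulrC ler_pdivlMr// => h.
  lra.
have := bound (Num.bound (6 * qnorm x)).
have := archi_boundP (mulr_ge0 (ler0n R 6) (qnorm_ge0 x)).
rewrite -natr1; lra.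
Qed.

End AdjointBounds.
End Adjoint.
End Complete.

(** * Transfer of frame bounds through the adjoint *)

Theorem theorem15 (R : realType) (H : rightQHilbertType R) (I : countType)
  (L : {linear H -> H}) (L_bounded : bounded_operator L)
  (u : I -> H) (A B : R) (u_frame : frame_with_bounds u A B) :
  is_frame (fun i => L (u i)) <-> set_surj [set: H] [set: H] L.
Proof.
have [A0 AB uP] := u_frame.
have [S SP] := adjoint_exists L_bounded.
have sumE v : \esum_(i in [set: I]) (modq (qinner (L (u i)) v) ^+ 2)%:E =
              \esum_(i in [set: I]) (modq (qinner (u i) (S v)) ^+ 2)%:E.
  by apply: eq_esum => i _; rewrite [qinner (u i) _]qinner_conj SP -qinner_conj.
have surjE : set_surj [set: H] [set: H] L <-> forall y, exists x, L x = y.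
  split=> [h y|h y _]; first by have [x _ xy] := h y Logic.I; exists x.
  by have [x xy] := h y; exists x.
apply: iff_trans (iff_sym surjE); split=> [[A' [B' [A'0 A'B' fP]]]|L_surj].
  (* The frame sum of L u_i at v is at least A' |v|^2 and at most B |S v|^2. *)
  apply: (surjective_of_adjoint_bounded_below L_bounded SP (c := A' / B)).
    by rewrite divr_gt0// (lt_le_trans A0).
  move=> v; have [h _] := fP v; have [_ h'] := uP (S v).
  move: h; rewrite sumE => /le_trans/(_ h'); rewrite lee_fin !sqr_qnorm.
  by rewrite mulrAC ler_pdivrMr ?(lt_le_trans A0)// [X in _ <= X]mulrC.
have [c c0 cS] := adjoint_bounded_below_of_surjective SP L_surj.
have [M M0 SM] := adjoint_bounded L_bounded SP.
have B0 : 0 < B by rewrite (lt_le_trans A0).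
(* The natural bounds are A c and B M. When H = 0, c and M are unrelated and these may be in the
   wrong order, hence the maximum. *)
exists (A * c), (Num.max (A * c) (B * M)); split.
- exact: mulr_gt0.
- by rewrite le_max lexx.
move=> v; rewrite sumE; have [h1 h2] := uP (S v).
have v0 := sym_form_ge0 (rinner_sym_form H) v.
split; [apply: le_trans h1 | apply: le_trans h2 _]; rewrite lee_fin !sqr_qnorm.
  by rewrite -mulrA ler_pM2l.
apply: (@le_trans _ _ (B * M * rinner v v)).
  by rewrite -mulrA ler_pM2l.
by rewrite ler_wpM2r// le_max lexx orbT.
Qed.
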